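(* (Testing for the existence of bunching.) Let $x_0\in\mathbb{R}$ and $n\ge1$. Let $\mathbb{P}_0$ be the set of probability distributions on $\mathbb{R}$ whose cumulative distribution function (CDF) is continuously differentiable, and let $\mathbb{P}_1$ be the set of mixed continuous–discrete probability distributions on $\mathbb{R}$ that have exactly one mass point, located at $x_0$, and whose CDF is continuously differentiable on $\mathbb{R}\setminus\{x_0\}$. Then for every $Q\in\mathbb{P}_1$ there is a sequence in the convex hull of $\{P^{\otimes n}:P\in\mathbb{P}_0\}$ converging in distribution to $Q^{\otimes n}$. Hence every test $\phi(Z)$ that is a.s. continuous under $Q^{\otimes n}$ for every $Q\in\mathbb{P}_1$ has power limited by size: $$\sup_{Q\in\mathbb{P}_1}\mathbb{E}_{Q^{\otimes n}}[\phi]\le\sup_{P\in\mathbb{P}_0}\mathbb{E}_{P^{\otimes n}}[\phi].$$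
   Context: The data are $Z=(X_1,\dots,X_n)$, i.i.d. real random variables with distribution $P\in\mathbb{P}_0\cup\mathbb{P}_1$, so $Z\sim P^{\otimes n}$. A distribution in $\mathbb{P}_1$ assigns to $\{x_0\}$ a probability $\delta\in(0,1)$. A test is a measurable function $\phi:\mathbb{R}^n\to[0,1]$; it is a.s. continuous under a distribution if its set of discontinuity points has probability zero. The convex hull of a set of distributions is the set of finite mixtures of its elements. *)

(* Defs.v *)
From HB Require Import structures.
From mathcomp Require Import all_boot all_order all_algebra.
From mathcomp Require Import all_classical all_reals all_analysis.

Set Implicit Arguments.
Unset Strict Implicit.
Unset Printing Implicit Defensive.
Import Order.TTheory GRing.Theory Num.Theory.
Import numFieldNormedType.Exports.
Local Open Scope classical_set_scope.
Local Open Scope ring_scope.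

(* R^n is n.-tuple R. The library provides its product sigma-algebra; the
   instance below adds the product topology. *)
HB.instance Definition _ (n : nat) (T : topologicalType) :=
  Topological.copy (n.-tuple T)
    (sup_topology (fun i : 'I_n => Topological.class
      (initial_topology (fun t : n.-tuple T => tnth t i)))).

Lemma cvg_tupleP (n : nat) (T : topologicalType)
    (F : set_system (n.-tuple T)) (t : n.-tuple T) : Filter F ->
  F --> t <-> forall i : 'I_n, tnth s i @[s --> F] --> tnth t i.
Proof.
move=> FF; split=> [Ft i | Ft].
  move/cvg_sup : Ft => /(_ i) Ft A nA; apply: Ft.
  exact: (@initial_continuous _ _ (fun s : n.-tuple T => tnth s i) t A nA).
apply/cvg_sup => i A [_ [[B oB <-] /= Bt] BA].
rewrite nbhs_filterE; apply: filterS BA _; apply: Ft.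
exact: open_nbhs_nbhs.
Qed.

Definition cons_tuple (T : Type) (n : nat) (p : T * n.-tuple T) :
  n.+1.-tuple T := [tuple of p.1 :: p.2].

Lemma measurable_cons_tuple d (T : measurableType d) (n : nat) :
  measurable_fun [set: T * n.-tuple T] (@cons_tuple T n).
Proof. by apply: measurable_cons. Qed.

HB.instance Definition _ d (T : measurableType d) (n : nat) :=
  isMeasurableFun.Build _ _ _ _ (@cons_tuple T n)
    (@measurable_cons_tuple d T n).

(* The n-fold product P^{\otimes n} on [n.-tuple T], obtained from the library's
   binary product measure by transport along [(x, t) |-> x :: t]; [iid_box]
   gives its values on measurable boxes. *)
Fixpoint iid d (T : measurableType d) (R : realType) (P : probability T R)
    (n : nat) : probability (n.-tuple T) R :=
  match n with
  | 0 => \d_([tuple] : 0.-tuple T)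
  | n'.+1 => distribution (P \x iid P n')%E (@cons_tuple T n')
  end.


Lemma measurable_tuple_box d (T : measurableType d) (n : nat)
    (A : 'I_n -> set T) : (forall i, measurable (A i)) ->
  measurable [set t : n.-tuple T | forall i, A i (tnth t i)].
Proof.
move=> mA.
have -> : [set t : n.-tuple T | forall i, A i (tnth t i)] =
    \big[setI/setT]_(i < n) ((fun t => tnth t i) @^-1` A i).
  rewrite -bigcap_seq; apply/seteqP; split=> t At i.
    by move=> _; exact: At.
  exact: (At i (mem_index_enum i)).
apply: bigsetI_measurable => i _; rewrite -[X in measurable X]setTI.
exact: measurable_tnth.
Qed.

Lemma iid_box d (T : measurableType d) (R : realType) (P : probability T R)
    (n : nat) (A : 'I_n -> set T) : (forall i, measurable (A i)) ->
  (iid P n [set t | forall i, A i (tnth t i)] = \prod_(i < n) P (A i))%E.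
Proof.
elim: n A => [|n IHn] A mA.
  by rewrite big_ord0 /= diracE mem_set// => -[].
rewrite big_ord_recl -IHn//= /distribution /pushforward.
rewrite -product_measure1E//; last first.
  by apply: (@measurable_tuple_box _ _ _ (fun i => A (lift ord0 i))) => i.
congr (_ _); apply/seteqP; split => -[x t]/= => [At|[Ax At] i].
  split => [|i]; first by have := At ord0; rewrite tnth0.
  by have := At (lift ord0 i); rewrite tnthS.
by case: (unliftP ord0 i) => [j ->|->]; rewrite ?tnthS ?tnth0.
Qed.


Definition cumul (R : realType) (P : probability R R) (x : R) : R :=
  fine (P `]-oo, x]%classic).

(* Meant for open [D]. *)
Definition continuously_differentiable_on (R : realType) (D : set R)
    (F : R -> R) : Prop :=
  (forall x, D x -> derivable F x 1) /\
  (forall x, D x -> {for x, continuous F^`()%classic}).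

Definition mass_points (R : realType) (P : probability R R) : set R :=
  [set x | (0 < P [set x])%E].

Definition distr0 (R : realType) : set (probability R R) :=
  [set P | continuously_differentiable_on setT (cumul P)].

(* [delta < 1] makes the distribution genuinely mixed: its continuous part has
   mass [1 - delta > 0]. *)
Definition distr1 (R : realType) (x0 : R) : set (probability R R) :=
  [set P | [/\ mass_points P = [set x0],
               exists2 delta : R, 0 < delta < 1 & P [set x0] = delta%:E &
               continuously_differentiable_on [set~ x0] (cumul P)]].

Definition convex_hull d (T : measurableType d) (R : realType)
    (S : set (probability T R)) : set (probability T R) :=
  [set mu | exists (m : nat) (w : 'I_m -> R) (nu : 'I_m -> probability T R),
    [/\ forall i, 0 <= w i,
        \sum_(i < m) w i = 1,
        forall i, S (nu i) &
        forall A, measurable A ->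
          mu A = (\sum_(i < m) (w i)%:E * nu i A)%E]].

Definition cvg_in_distribution (R : realType) (n : nat)
    (mu : nat -> probability (n.-tuple R) R)
    (nu : probability (n.-tuple R) R) : Prop :=
  forall f : n.-tuple R -> R, continuous f -> bounded_fun f ->
    ('E_(mu k)[f] @[k --> \oo] --> 'E_nu[f])%E.

Definition is_test (R : realType) (n : nat) (phi : n.-tuple R -> R) : Prop :=
  measurable_fun [set: n.-tuple R] phi /\ forall z, 0 <= phi z <= 1.

Definition as_continuous (R : realType) (n : nat)
    (mu : probability (n.-tuple R) R) (phi : n.-tuple R -> R) : Prop :=
  mu.-negligible [set z | ~ {for z, continuous phi}].

(* Main.v *)
(* Noise removes the mass point: if X has law Q and U is an independent standard
   normal variable, then X + hU has CDF y |-> E[F_U((y - X) / h)], which can be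
   differentiated under the expectation because F_U is C^1 with bounded
   derivative, so its law belongs to [distr0]. With h = 1/(k+1), the samples
   (X_i + h U_i)_i, all defined on the space carrying (X_i, U_i)_i, converge
   everywhere to (X_i)_i; hence dominated convergence gives the convergence of
   the expectation of any bounded measurable function that is continuous
   (iid Q n)-a.s., which covers both the continuous bounded functions (weak
   convergence) and the tests. *)

Require Import Defs.
From HB Require Import structures.
From mathcomp Require Import all_boot all_order all_algebra.
From mathcomp Require Import all_classical all_reals all_analysis.
From mathcomp Require Import measurable_realfun.

Set Implicit Arguments.
Unset Strict Implicit.
Unset Printing Implicit Defensive.
Import Order.TTheory GRing.Theory Num.Theory.
Import numFieldNormedType.Exports.
Local Open Scope classical_set_scope.
Local Open Scope ring_scope.

(** * Image laws, measurability and coupling for samples *)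

Lemma measurable_map_tuple d d' (T : measurableType d) (T' : measurableType d')
    (f : T -> T') (n : nat) : measurable_fun [set: T] f ->
  measurable_fun [set: n.-tuple T] (fun t => map_tuple f t).
Proof.
move=> mf; apply/measurable_fun_tnthP => i.
rewrite (_ : _ \o _ = fun t : n.-tuple T => f (tnth t i)).
  by apply: measurableT_comp => //; exact: measurable_tnth.
by apply/funext => t /=; rewrite tnth_map.
Qed.

(** Image laws commute with powers: by induction on [n], the integral over the first coordinate is
    changed along [f], and each section of [A] is handled by the induction hypothesis. *)
Lemma iid_map_tuple d d' (T : measurableType d) (T' : measurableType d')
    (R : realType) (P : probability T R) (P' : probability T' R)
    (f : T -> T') : measurable_fun [set: T] f ->
  (forall A, measurable A -> P' A = P (f @^-1` A)) ->
  forall (n : nat) (A : set (n.-tuple T')), measurable A ->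
  iid P' n A = iid P n ((fun t => map_tuple f t) @^-1` A).
Proof.
move=> mf P'E; elim=> [|n IHn] A mA /=.
  rewrite !diracE; congr (_%:R%:E)%R; congr nat_of_bool.
  apply/idP/idP; rewrite !inE /preimage /=;
    by rewrite (_ : map_tuple f _ = [tuple])//; exact: val_inj.
rewrite /distribution /pushforward /= /product_measure1.
have mB : measurable (@Defs.cons_tuple T' n @^-1` A).
  by rewrite -[X in measurable X]setTI; exact: (measurable_cons_tuple measurableT).
rewrite (@eq_measure_integral _ _ _ _ (pushforward P f)); last first.
  by move=> B mB' _; exact: P'E.
rewrite ge0_integral_pushforward//=; last first.
  exact: measurable_fun_xsection.
apply: eq_integral => x _ /=; rewrite IHn; last exact: measurable_xsection.
congr (iid P n _); apply/seteqP; split => t;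
  by rewrite /preimage/= /xsection/= !inE/=; congr A; exact: val_inj.
Qed.

Lemma continuous_measurable_tuple (R : realType) (n : nat)
    (f : n.-tuple R -> R) : continuous f -> measurable_fun [set: n.-tuple R] f.
Proof.
(* [f] is the pointwise limit of its compositions with rounding to a countable
   grid, and any function is measurable after such a rounding. *)
move=> cf.
pose digits k (t : n.-tuple R) : n.-tuple int :=
  map_tuple (fun x => Num.floor (x * k.+1%:R)) t.
pose grid k (z : n.-tuple int) : n.-tuple R :=
  map_tuple (fun m : int => m%:~R / k.+1%:R) z.
apply: (@measurable_fun_cvg _ _ _ _ (fun k => f \o grid k \o digits k)).
  move=> k _ Y mY; rewrite setTI.
  (* [digits k] takes countably many values [z]; each contributes either nothing or a box of
     half-open cells, depending on whether [f (grid k z)] lies in [Y]. *)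
  have -> : (f \o grid k \o digits k) @^-1` Y =
      \bigcup_z [set t | digits k t = z /\ Y (f (grid k z))].
    apply/seteqP; split => [t /= Yt|t [z _ [<-]]//].
    by exists (digits k t).
  apply: countable_bigcupT_measurable; first exact: countableP.
  move=> z.
  have [Yz|nYz] := pselect (Y (f (grid k z))); last first.
    rewrite (_ : [set _ | _] = set0); first exact: measurable0.
    by apply/seteqP; split => // t [].
  pose cell (i : 'I_n) : set R :=
    `[(tnth z i)%:~R / k.+1%:R, (tnth z i + 1)%:~R / k.+1%:R[%classic.
  rewrite (_ : [set _ | _] = [set t | forall i, cell i (tnth t i)]).
    by apply: (@measurable_tuple_box _ _ _ cell) => i; exact: measurable_itv.
  apply/seteqP; split => t /=.
    move=> [zE _] i; rewrite /cell/= in_itv/= -zE tnth_map.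
    rewrite ler_pdivrMr ?ltr0Sn// ltr_pdivlMr ?ltr0Sn//.
    exact: floor_itv.
  move=> h; split => //; apply: eq_from_tnth => i; rewrite /digits tnth_map.
  apply: floor_def; have := h i; rewrite /cell/= in_itv/=.
  by rewrite ler_pdivrMr ?ltr0Sn// ltr_pdivlMr ?ltr0Sn.
move=> t _; apply: (@cvg_comp _ _ _ (fun k => grid k (digits k t)) f _ (nbhs t));
  last exact: cf.
apply/cvg_tupleP => i.
(* Rounding down to the grid lowers a coordinate by at most [1 / (k + 1)]. *)
apply: (@squeeze_cvgr _ _ _ _ (fun k => tnth t i - @harmonic R k) (fun=> tnth t i)).
- apply: nearW => k; rewrite /grid /digits !tnth_map.
  have /andP[fl fu] := floor_itv (tnth t i * k.+1%:R).
  rewrite ler_pdivrMr ?ltr0Sn// fl andbT /harmonic.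
  rewrite ler_pdivlMr ?ltr0Sn// mulrBl mulVf ?pnatr_eq0// lerBlDr ltW//.
  by rewrite -[X in _ + X]/(1%:~R) -intrD.
- by rewrite -[X in _ --> X]subr0; apply: cvgB; [exact: cvg_cst|exact: cvg_harmonic].
- exact: cvg_cst.
Qed.

(** A change of variables turns all the expectations into integrals over the single space [iid P n],
    where dominated convergence applies. *)
Lemma cvg_expectation_coupling d (T : measurableType d) (R : realType)
    (P : probability T R) (X_ : nat -> T -> R) (X : T -> R)
    (P_ : nat -> probability R R) (Q : probability R R) (n : nat)
    (phi : n.-tuple R -> R) :
  (forall k, measurable_fun [set: T] (X_ k)) -> measurable_fun [set: T] X ->
  (forall k A, measurable A -> P_ k A = P (X_ k @^-1` A)) ->
  (forall A, measurable A -> Q A = P (X @^-1` A)) ->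
  (forall x, X_ k x @[k --> \oo] --> X x) ->
  measurable_fun [set: n.-tuple R] phi -> bounded_fun phi ->
  as_continuous (iid Q n) phi ->
  ('E_(iid (P_ k) n)[phi] @[k --> \oo] --> 'E_(iid Q n)[phi])%E.
Proof.
move=> mX_ mX P_E QE X_X mphi bphi [N [mN N0 phiN]].
have expE (P' : probability R R) (Y : T -> R) : measurable_fun setT Y ->
    (forall A, measurable A -> P' A = P (Y @^-1` A)) ->
    ('E_(iid P' n)[phi] = \int[iid P n]_t (phi (map_tuple Y t))%:E)%E.
  move=> mY P'E; rewrite unlock.
  have mg := measurable_map_tuple (n := n) mY.
  pose g : {mfun n.-tuple T >-> n.-tuple R} :=
    HB.pack (fun t : n.-tuple T => map_tuple Y t)
      (isMeasurableFun.Build _ _ _ _ _ mg).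
  rewrite (@eq_measure_integral _ _ _ _ (distribution (iid P n) g)); last first.
    by move=> A mA _; exact: (iid_map_tuple mY P'E).
  rewrite integral_distribution//; first by apply/measurable_EFinP.
  apply: (@measurable_bounded_integrable _ _ _ _ (phi \o g)) => //.
  - by rewrite (le_lt_trans (probability_le1 _ _))// ltry.
  - exact: measurableT_comp.
  - by case: bphi => M [Mr hM]; exists M; split => // x Mx t _ /=; exact: hM.
have [M phiM] : exists M : R, forall z, `|phi z| <= M.
  (* [bounded_fun] only provides bounds strictly above [M], hence [M + 1]. *)
  by case: bphi => M [Mr hM]; exists (M + 1) => z; apply: hM => //; rewrite ltrDl.
rewrite (expE _ _ mX QE).
under eq_fun do rewrite (expE _ _ (mX_ _) (P_E _)).
have mp Y : measurable_fun [set: T] Y ->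
    measurable_fun setT (fun t : n.-tuple T => (phi (map_tuple Y t))%:E).
  move=> mY; apply/measurable_EFinP; apply: measurableT_comp => //.
  exact: measurable_map_tuple.
have [|||||//] := @dominated_convergence _ _ _ (iid P n) setT measurableT
  (fun k t => (phi (map_tuple (X_ k) t))%:E)
  (fun t => (phi (map_tuple X t))%:E) (cst M%:E).
- by move=> k; exact: mp.
- exact: mp.
(* The exceptional set is pulled back from the null set [N] containing the discontinuities of [phi];
   it is null because [map_tuple X] carries [iid P n] to [iid Q n]. *)
- exists ((fun t => map_tuple X t) @^-1` N); split.
  + rewrite -[X in measurable X]setTI; exact: measurable_map_tuple.
  + by rewrite -N0; apply/esym; exact: (iid_map_tuple mX QE).
  + move=> t /= nt; apply: phiN => /= cphi; apply: nt => _.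
    apply: cvg_EFin; first exact: nearW.
    apply: (@cvg_comp _ _ _ (fun k => map_tuple (X_ k) t) phi _
      (nbhs (map_tuple X t))); last exact: cphi.
    apply/cvg_tupleP => i; rewrite tnth_map.
    suff : tnth (map_tuple (X_ k) t) i @[k --> \oo] --> X (tnth t i) by [].
    by under eq_cvg do rewrite tnth_map; exact: X_X.
- exact: finite_measure_integrable_cst.
- by apply: (aeW (iid P n)) => t k _; rewrite lee_fin.
Qed.

(** * Smoothing a law by independent scaled noise *)

Definition add_scaled (R : realType) (h : R) (p : R * R) : R := p.1 + h * p.2.

Lemma measurable_add_scaled (R : realType) (h : R) :
  measurable_fun [set: R * R] (add_scaled h).
Proof. by apply: measurable_funD => //; exact: measurable_funM. Qed.

HB.instance Definition _ (R : realType) (h : R) :=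
  isMeasurableFun.Build _ _ _ _ (add_scaled h) (measurable_add_scaled h).

Lemma cumulE (R : realType) (P : probability R R) (x : R) :
  P `]-oo, x]%classic = (cumul P x)%:E.
Proof. by rewrite /cumul fineK// fin_num_measure. Qed.

Lemma cumul_ge0_le1 (R : realType) (P : probability R R) (x : R) :
  0 <= cumul P x <= 1.
Proof.
by rewrite -!lee_fin -cumulE measure_ge0 probability_le1.
Qed.

(** The product measure integrates the measures of sections, and since [h > 0] the section of
    [x + h * u <= y] at [x] is the half-line [u <= (y - x) / h]. *)
Lemma cumul_add_scaled (R : realType) (Q U : probability R R) (h : R) (y : R) :
  0 < h ->
  cumul (distribution (Q \x U)%E (add_scaled h)) y =
  \int[Q]_x cumul U ((y - x) / h).
Proof.
move=> h0; rewrite /cumul /Rintegral; congr fine.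
rewrite /distribution /pushforward /= /product_measure1.
apply: eq_integral => x _ /=; rewrite fineK ?fin_num_measure//.
congr (U _); apply/seteqP; split=> u;
  rewrite /xsection /= in_setE /preimage /add_scaled /= !in_itv/=;
  by rewrite ler_pdivlMr// lerBrDl mulrC.
Qed.

(** The integrand of [cumul_add_scaled] has [y]-derivative [g], bounded by the constant [M / h],
    which is [Q]-integrable. This one bound justifies both differentiation under the integral and
    continuity of the resulting derivative. *)
Lemma distr0_add_scaled (R : realType) (Q U : probability R R) (h M : R) :
  0 < h -> distr0 U -> (forall x, `|(cumul U)^`()%classic x| <= M) ->
  distr0 (distribution (Q \x U)%E (add_scaled h)).
Proof.
move=> h0 [dU cU] UM.
pose f (y x : R) := cumul U ((y - x) / h).
pose g (y x : R) : R := (cumul U)^`()%classic ((y - x) / h) / h.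
have M0 : 0 <= M by rewrite (le_trans _ (UM 0)).
have cumulU_cont : continuous (cumul U).
  by move=> x; apply/differentiable_continuous/derivable1_diffP; exact: dU.
have aff_cont x : continuous (fun y : R => (y - x) / h).
  by move=> y; apply: cvgMl; apply: cvgB; [exact: cvg_id|exact: cvg_cst].
have aff_cont' y : continuous (fun x : R => (y - x) / h).
  by move=> x; apply: cvgMl; apply: cvgB; [exact: cvg_cst|exact: cvg_id].
have dg (x y : R) : is_derive y (1 : R) (f ^~ x) (g y x).
  have dU' : is_derive ((y - x) / h) (1 : R) (cumul U)
      ((cumul U)^`()%classic ((y - x) / h)).
    by rewrite derive1E; apply/derivableP; exact: dU.
  have daff : is_derive y (1 : R) (fun y : R => (y - x) / h) h^-1.
    rewrite (_ : (fun _ => _) = h^-1 \*: (id - cst x)); last first.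
      by apply/funext => z; rewrite /= mulrC.
    by apply: is_derive_eq; rewrite subr0 scaler1.
  exact: (is_derive1_comp (f := cumul U) (g := fun y : R => (y - x) / h)).
have Qfin : (Q setT < +oo)%E by rewrite (le_lt_trans (probability_le1 _ _))// ltry.
have intf y : Q.-integrable setT (EFin \o f y).
  apply: measurable_bounded_integrable => //.
    apply: continuous_measurable_fun => x.
    exact: (continuous_comp (aff_cont' y x) (cumulU_cont _)).
  exists 1; split => // r r1 x _ /=.
  have /andP[f0 f1] := cumul_ge0_le1 U ((y - x) / h).
  by rewrite ger0_norm// (le_trans f1)// ltW.
have gM x y : `|g y x| <= M / h.
  by rewrite normrM ler_pM// gtr0_norm// invr_gt0.
have intg y : Q.-integrable setT (EFin \o g y).
  apply: measurable_bounded_integrable => //.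
    apply: continuous_measurable_fun => x; apply: cvgMl.
    exact: (continuous_comp (aff_cont' y x) (cU _ _)).
  exists (M / h); split => [|r r1 x _]; first exact: num_real.
  exact: le_trans (gM x y) (ltW r1).
have d1f : partial1of2 f = g.
  apply/funext => y; apply/funext => x; rewrite /partial1of2 derive1E.
  exact: derive_val.
have cE : cumul (distribution (Q \x U)%E (add_scaled h)) =
    fun y => \int[Q]_x f y x.
  by apply/funext => y; exact: cumul_add_scaled.
(* The theorems on integrals with a parameter work on an open interval around [y]; the bound on [g]
   is global, so any width will do. *)
have Iy (y : R) : `]y - 1, y + 1[%classic y.
  by rewrite /= in_itv/= ltrBlDr ltrDl ltr01.
have intM : Q.-integrable setT (EFin \o cst (M / h)).
  exact: finite_measure_integrable_cst.
have gub y x : setT x -> `|partial1of2 f y x| <= M / h.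
  by move=> _; rewrite d1f.
have Mh0 : 0 <= M / h by rewrite divr_ge0// ltW.
rewrite /distr0 /= cE; split => [y _|].
  apply: (@derivable_under_integral _ _ _ Q f setT measurableT y (y - 1) (y + 1)
    (Iy y) _ _ (cst (M / h))) => //.
  by move=> z x _ _; exact: gub.
have -> : (fun y => \int[Q]_x f y x)^`()%classic = fun y => \int[Q]_x g y x.
  apply/funext => y.
  rewrite (@differentiation_under_integral _ _ _ Q f setT measurableT y (y - 1)
    (y + 1) (Iy y) _ _ (cst (M / h)))//.
  - by rewrite d1f.
  by move=> z x _ _; exact: gub.
move=> y _.
apply: (@continuity_under_integral _ _ _ Q g setT measurableT (y - 1) (y + 1)
  _ _ (cst (M / h))) => //.
- apply: (aeW Q) => x _ z _; apply: cvgMl.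
  exact: (continuous_comp (aff_cont x z) (cU _ _)).
- by move=> z _; apply: (aeW Q) => x _.
- by rewrite inE.
Qed.

(** * The standard normal law as noise *)

Definition of_measurableTypeR (R : realType) : measurableTypeR R -> R := idfun.

HB.instance Definition _ (R : realType) :=
  @isMeasurableFun.Build _ _ _ _ (@of_measurableTypeR R)
    (@measurable_id _ _ setT).

(* The library's [normal_prob] lives on [measurableTypeR R], whose display
   differs from that of [R] although the measurable sets are the same. *)
Definition std_normal (R : realType) : probability R R :=
  distribution (normal_prob (0 : R) 1) (@of_measurableTypeR R).

(** By unfolding, this CDF is the integral of the density from [-oo] to [x], so the fundamental
    theorem of calculus applies; [x + 1] merely supplies an endpoint beyond [x]. *)
Lemma is_derive_cumul_std_normal (R : realType) (x : R) :
  derivable (cumul (std_normal R)) x 1 /\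
  (cumul (std_normal R))^`()%classic x = normal_pdf 0 1 x.
Proof.
have := @continuous_FTC1 R (normal_pdf 0 1) -oo%O x (x + 1).
apply.
- by rewrite ltrDl.
- by apply: integrableS (integrable_normal_pdf 0 1).
- by rewrite ltNyr.
- by apply: continuous_normal_pdf; exact: oner_neq0.
Qed.

Lemma distr0_std_normal (R : realType) : distr0 (std_normal R).
Proof.
split=> x _; first exact: (is_derive_cumul_std_normal x).1.
rewrite (_ : (cumul _)^`()%classic = normal_pdf 0 1).
  by apply: continuous_normal_pdf; exact: oner_neq0.
by apply/funext => y; exact: (is_derive_cumul_std_normal y).2.
Qed.

Theorem corollary5 (R : realType) (x0 : R) (n : nat) (n_ge1 : (1 <= n)%N) :
  (forall Q : probability R R, distr1 x0 Q ->
    exists mu : nat -> probability (n.-tuple R) R,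
      (forall k : nat, convex_hull [set iid P n | P in @distr0 R] (mu k)) /\
      cvg_in_distribution mu (iid Q n)) /\
  (forall phi : n.-tuple R -> R, is_test phi ->
    (forall Q : probability R R, distr1 x0 Q -> as_continuous (iid Q n) phi) ->
    (ereal_sup [set 'E_(iid Q n)[phi] | Q in distr1 x0] <=
     ereal_sup [set 'E_(iid P n)[phi] | P in @distr0 R])%E).
Proof.
pose P_ (Q : probability R R) (k : nat) : probability R R :=
  distribution (Q \x std_normal R)%E (add_scaled (k.+1%:R^-1)).
have P_distr0 Q k : distr0 (P_ Q k).
  (* [normal_peak 1] is the maximum of the standard normal density, hence bounds the derivative of
     its CDF. *)
  apply: (@distr0_add_scaled _ _ _ _ (normal_peak 1)).
  - by rewrite invr_gt0.
  - exact: distr0_std_normal.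
  - move=> x; rewrite (is_derive_cumul_std_normal x).2.
    by rewrite ger0_norm ?normal_pdf_ge0// normal_pdf_ub// oner_neq0.
have P_cvg Q (phi : n.-tuple R -> R) : measurable_fun setT phi -> bounded_fun phi ->
    as_continuous (iid Q n) phi ->
    ('E_(iid (P_ Q k) n)[phi] @[k --> \oo] --> 'E_(iid Q n)[phi])%E.
  apply: (@cvg_expectation_coupling _ _ _ (Q \x std_normal R)%E
    (fun k => add_scaled k.+1%:R^-1) fst) => //.
  (* The first projection has law [Q]: the product measure of [A] times the whole line is
     [Q A * 1]. *)
  - move=> A mA; rewrite -[in RHS](setTI (fst @^-1` A)).
    rewrite (_ : _ `&` _ = A `*` setT); last first.
      by apply/seteqP; split => -[x u]//= [].
    apply: esym; rewrite -[RHS]mule1 -(probability_setT (std_normal R)).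
    exact: product_measure1E.
  - move=> [x u]; rewrite /add_scaled /=.
    rewrite -[X in _ --> X]addr0 -[X in _ --> _ + X](mul0r u).
    apply: cvgD; first exact: cvg_cst.
    by apply: cvgMl; exact: cvg_harmonic.
split=> [Q Q1|phi [mphi phi01] cphi].
  exists (fun k => iid (P_ Q k) n); split=> [k|f cf bf].
    (* A mixture with a single component of weight 1 suffices. *)
    exists 1%N, (fun=> 1), (fun=> iid (P_ Q k) n); split => //.
    - by rewrite big_ord1.
    - by move=> _; exists (P_ Q k).
    - by move=> A mA; rewrite big_ord1 mul1e.
  apply: P_cvg => //; first exact: continuous_measurable_tuple.
  exists set0; split; [exact: measurable0|exact: measure0|].
  by move=> z; apply; exact: cf.
apply: ge_ereal_sup => _ [Q Q1 <-].
have bphi : bounded_fun phi.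
  exists 1; split => // r r1 z _ /=.
  have /andP[p0 p1] := phi01 z.
  by rewrite ger0_norm// (le_trans p1)// ltW.
have cvgQ := P_cvg Q phi mphi bphi (cphi Q Q1).
(* The power at [Q] is the limit of expectations under laws of [distr0], each at most the supremum
   on the right. *)
rewrite -(cvg_lim _ cvgQ)//; apply: lime_le.
  by apply/cvg_ex; eexists; exact: cvgQ.
by apply: nearW => k; apply: ereal_sup_ubound; exists (P_ Q k).
Qed.
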